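(* Let $M=\varprojlim M_i$ be a projective limit of Banach manifolds. The limit $\nabla=\varprojlim\nabla_i$ of a projective system of connections $\{\nabla_i\}_{i\in\mathbb N}$, $\nabla_i$ being a connection on $M_i$, is a connection on $M=\varprojlim M_i$.
   Context: Setting. $\{(M_i,\varphi_{ji})\}$ is a projective system of smooth Banach manifolds (with smooth connecting maps $\varphi_{ji}:M_j\to M_i$ for $j\ge i$), where $M_i$ is modelled on the Banach space $\mathbb E_i$ and $\{\mathbb E_i,\rho_{ji}\}$ is a projective system of Banach spaces with continuous linear maps $\rho_{ji}:\mathbb E_j\to\mathbb E_i$ and limit the Fréchet space $\mathbb F=\varprojlim\mathbb E_i$. Every $m=(m_i)\in M=\varprojlim M_i$ is assumed to have a projective system of charts $(U_i,\varphi_i)$ of $M_i$, $m_i\in U_i$, $\varphi_{ji}(U_j)\subseteq U_i$, $\varphi_i\circ\varphi_{ji}=\rho_{ji}\circ\varphi_j$ on $U_j$, such that $U=\varprojlim U_i$ is open in $M$ and $\varphi=\varprojlim\varphi_i$ maps $U$ onto an open subset of $\mathbb F$. Such $(U,\varphi)$ are the (projective limit) charts, which make $M$ a Fréchet manifold modelled on $\mathbb F$. $L^2(\mathbb E,\mathbb E)$ is the space of continuous bilinear maps $\mathbb E\times\mathbb E\to\mathbb E$, and $\mathcal H^2(\mathbb F,\mathbb F)$ is the Fréchet space of sequences $(B_i)\in\prod_iL^2(\mathbb E_i,\mathbb E_i)$ with $B_i\circ(\rho_{ji}\times\rho_{ji})=\rho_{ji}\circ B_j$ for $j\ge i$. Vector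 fields on $M$ are those of the form $X=\varprojlim X_i$ with $X_i$ a smooth vector field on $M_i$ and $T\varphi_{ji}\circ X_j=X_i\circ\varphi_{ji}$. $X_\varphi$ denotes the principal part of $X$ in the chart $(U,\varphi)$. A connection on a Banach manifold $N$ modelled on $\mathbb E$ is a map $(X,Y)\mapsto\nabla_XY$ on smooth vector fields such that for every chart $(U,\varphi)$ there is a smooth $\Gamma_\varphi:\varphi(U)\to L^2(\mathbb E,\mathbb E)$ with $(\nabla_XY)_\varphi(u)=DY_\varphi(u).X_\varphi(u)-\Gamma_\varphi(u)(X_\varphi(u),Y_\varphi(u))$. Connections $\nabla_i$ on $M_i$ form a projective system if in projective limit charts $\rho_{ji}\circ\Gamma_{\varphi_j}(u_j)=\Gamma_{\varphi_i}(\rho_{ji}u_j)\circ(\rho_{ji}\times\rho_{ji})$ for $j\ge i$; the limit is $\nabla_XY=\varprojlim(\nabla_i)_{X_i}Y_i$ for $X=\varprojlim X_i$, $Y=\varprojlim Y_i$. A connection on $M$ is a map $(X,Y)\mapsto\nabla_XY$ on vector fields of $M$ which in every projective limit chart is given by the same local formula with a smooth map $\Gamma_\varphi=\varprojlim\Gamma_{\varphi_i}:\varphi(U)\to\mathcal H^2(\mathbb F,\mathbb F)$.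
   Formalization: For vector fields X = lim X_i on M, the relation Tφ_ji∘X_j = X_i∘φ_ji is required only on the domains U_j of projective limit charts, not on all of M_j; with the global condition the claim can fail when the U_j do not cover M_j. *)

(* Defs.v *)
From HB Require Import structures.
From mathcomp Require Import all_boot all_order all_algebra.
From mathcomp Require Import all_classical all_reals all_analysis.

Set Implicit Arguments.
Unset Strict Implicit.
Unset Printing Implicit Defensive.

Import Order.TTheory GRing.Theory Num.Theory.
Import numFieldNormedType.Exports.

Local Open Scope classical_set_scope.
Local Open Scope ring_scope.

(** * Normed spaces of maps *)

(* A linear space of maps [V -> W] that are bounded on the closed unit ball
   and determined by their restriction to it; it is normed by the supremum
   over the unit ball. *)
Record opspace (R : realType) (V W : normedModType R) := Opspace {
  opmem :> (V -> W) -> Prop;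
  opmem0 : opmem (fun=> 0);
  opmem_lin : forall a f g, opmem f -> opmem g ->
    opmem (fun x => a *: f x + g x);
  opmem_bounded : forall f, opmem f ->
    exists M, forall x, `|x| <= 1 -> `|f x| <= M;
  opmem_eq0 : forall f, opmem f -> (forall x, `|x| <= 1 -> f x = 0) ->
    forall x, f x = 0 }.

Record opmap (R : realType) (V W : normedModType R) (S : opspace V W) :=
  Opmap { opfun :> V -> W ; opfunP : S opfun }.

Section opmap.
Context (R : realType) (V W : normedModType R) (S : opspace V W).
Implicit Types f g h : opmap S.

Lemma opmap_eq f g : (forall x, f x = g x) -> f = g.
Proof.
case: f g => [f fP] [g gP] /= /funext fg; subst g.
by congr Opmap; exact: Prop_irrelevance.
Qed.

HB.instance Definition _ := gen_eqMixin (opmap S).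
HB.instance Definition _ := gen_choiceMixin (opmap S).

Definition op0 : opmap S := Opmap (opmem0 S).

Definition oplin (a : R) f g : opmap S :=
  Opmap (opmem_lin a (opfunP f) (opfunP g)).

Definition opadd f g := oplin 1 f g.
Definition opscale a f := oplin a f op0.
Definition opopp f := opscale (-1) f.

Let opaddA : associative opadd.
Proof. by move=> f g h; apply: opmap_eq => x /=; rewrite !scale1r addrA. Qed.
Let opaddC : commutative opadd.
Proof. by move=> f g; apply: opmap_eq => x /=; rewrite !scale1r addrC. Qed.
Let opadd0 : left_id op0 opadd.
Proof. by move=> f; apply: opmap_eq => x /=; rewrite !scale1r add0r. Qed.
Let opaddN : left_inverse op0 opopp opadd.
Proof.
by move=> f; apply: opmap_eq => x /=; rewrite scale1r addr0 scaleN1r addNr.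
Qed.

HB.instance Definition _ :=
  GRing.isZmodule.Build (opmap S) opaddA opaddC opadd0 opaddN.

Lemma opaddE f g x : (f + g) x = f x + g x.
Proof. by rewrite /= scale1r. Qed.

Let opscaleA a b f : opscale a (opscale b f) = opscale (a * b) f.
Proof. by apply: opmap_eq => x /=; rewrite !addr0 scalerA. Qed.
Let opscale1 : left_id 1 opscale.
Proof. by move=> f; apply: opmap_eq => x /=; rewrite addr0 scale1r. Qed.
Let opscaleDr : right_distributive opscale +%R.
Proof.
by move=> a f g; apply: opmap_eq => x; rewrite /= !addr0 !scale1r scalerDr.
Qed.
Let opscaleDl f : {morph opscale^~ f : a b / a + b}.
Proof.
by move=> a b; apply: opmap_eq => x; rewrite /= !addr0 !scale1r scalerDl.
Qed.

HB.instance Definition _ := GRing.Zmodule_isLmodule.Build R (opmap S)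
  opscaleA opscale1 opscaleDr opscaleDl.

Lemma opscaleE a f x : (a *: f) x = a *: f x.
Proof. by rewrite /= addr0. Qed.

Definition opnorm f : R := sup [set `|f x| | x in [set x | `|x| <= 1]].

Lemma opnorm_has_sup f : has_sup [set `|f x| | x in [set x | `|x| <= 1]].
Proof.
split; first by exists `|f 0|, 0 => //=; rewrite normr0.
have [M fM] := opmem_bounded (opfunP f).
by exists M => _ [x /= x1 <-]; exact: fM.
Qed.

Lemma opnorm_ub f x : `|x| <= 1 -> `|f x| <= opnorm f.
Proof. by move=> x1; apply: ub_le_sup; [case: (opnorm_has_sup f)|exists x]. Qed.

Lemma opnorm_le f M : (forall x, `|x| <= 1 -> `|f x| <= M) -> opnorm f <= M.
Proof.
move=> fM; apply: ge_sup; first by case: (opnorm_has_sup f).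
by move=> _ [x /= x1 <-]; exact: fM.
Qed.

Let opnormD f g : opnorm (f + g) <= opnorm f + opnorm g.
Proof.
apply: opnorm_le => x x1; rewrite opaddE (le_trans (ler_normD _ _))//.
by rewrite lerD// opnorm_ub.
Qed.

Let opnormZ_le (a : R) f : opnorm (a *: f) <= `|a| * opnorm f.
Proof.
by apply: opnorm_le => x x1; rewrite opscaleE normrZ ler_wpM2l// opnorm_ub.
Qed.

Let opnormZ (a : R) f : opnorm (a *: f) = `|a| * opnorm f.
Proof.
apply/eqP; rewrite eq_le opnormZ_le /=.
have [->|a0] := eqVneq a 0.
  rewrite normr0 mul0r; have := @opnorm_ub (0 *: f) 0.
  by rewrite normr0 => /(_ ler01); exact: le_trans.
rewrite -ler_pdivlMl ?normr_gt0// -normfV (le_trans _ (opnormZ_le _ _))//.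
by rewrite scalerA mulVf// scale1r.
Qed.

Let opnorm_eq0 f : opnorm f = 0 -> f = 0.
Proof.
move=> f0; apply: opmap_eq; apply: (opmem_eq0 (opfunP f)) => x x1.
by apply/eqP; rewrite -normr_le0 -f0 opnorm_ub.
Qed.

HB.instance Definition _ := Lmodule_isNormed.Build R (opmap S)
  opnormD opnormZ opnorm_eq0.

(* [f] as an element of the space, or the junk value 0 *)
Definition to_opmap (f : V -> W) : opmap S :=
  if pselect (S f) is left fS then Opmap fS else 0.

End opmap.

Section linear_bilinear.
Context (R : realType) (V W : normedModType R).

Definition lin_mem (f : V -> W) : Prop :=
  linear f /\ continuous f.

Definition bilin_mem (B : V * V -> W) : Prop :=
  [/\ forall y, linear (fun x => B (x, y)),
      forall x, linear (fun y => B (x, y)) & continuous B].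

Lemma lin_mem0 : lin_mem (fun=> 0).
Proof.
by split; [move=> a x y; rewrite scaler0 addr0|move=> x; exact: cvg_cst].
Qed.

Lemma lin_mem_lin a f g : lin_mem f -> lin_mem g ->
  lin_mem (fun x => a *: f x + g x).
Proof.
move=> [fl fc] [gl gc]; split.
  by move=> b x y; rewrite fl gl !scalerDr !scalerA addrACA (mulrC a).
by move=> x; apply: cvgD; [apply: cvgZr; exact: fc|exact: gc].
Qed.

(* a map which is homogeneous of some degree and continuous at 0 *)
Lemma homogeneous_bounded (V' : normedModType R) (n : nat) (f : V' -> W) :
  f 0 = 0 -> (forall a x, f (a *: x) = a ^+ n *: f x) -> {for 0, continuous f} ->
  exists M, forall x, `|x| <= 1 -> `|f x| <= M.
Proof.
move=> f0 fZ fc; move: fc; rewrite /prop_for /continuous_at f0.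
move=> /cvgrPdist_le /(_ 1 ltr01) /nbhs_norm0P [e /= e0 fe].
pose d := e / 2; have d0 : 0 < d by rewrite divr_gt0.
exists (d ^+ n)^-1 => x x1.
have : `|f (d *: x)| <= 1.
  rewrite -normrN -sub0r; apply: fe; rewrite /= normrZ gtr0_norm//.
  rewrite (le_lt_trans (ler_wpM2l (ltW d0) x1))// mulr1.
  by rewrite ltr_pdivrMr// ltr_pMr// ltr1n.
by rewrite fZ normrZ gtr0_norm ?exprn_gt0// -ler_pdivlMl ?exprn_gt0// mulr1.
Qed.

Lemma homogeneous_eq0 (V' : normedModType R) (n : nat) (f : V' -> W) :
  (forall a x, f (a *: x) = a ^+ n *: f x) ->
  (forall x, `|x| <= 1 -> f x = 0) -> forall x, f x = 0.
Proof.
move=> fZ f0 x; have [->|x0] := eqVneq x 0.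
  by apply: f0; rewrite normr0.
have nx : `|x| != 0 by rewrite normr_eq0.
rewrite -[x](scalerKV nx) fZ [f _]f0 ?scaler0//.
by rewrite normrZ normfV normr_id mulVf.
Qed.

Lemma lin_memZ f : lin_mem f -> forall a x, f (a *: x) = a ^+ 1 *: f x.
Proof.
move=> [fl _] a x; have f0 : f 0 = 0.
  by have := fl (-1) 0 0; rewrite scaler0 add0r scaleN1r addNr.
by have := fl a x 0; rewrite !addr0 f0 addr0 expr1.
Qed.

Lemma lin_mem_f0 f : lin_mem f -> f 0 = 0.
Proof. by move=> fP; have := lin_memZ fP 0 0; rewrite expr1 !scale0r. Qed.

Lemma bilin_mem0 : bilin_mem (fun=> 0).
Proof.
split; [move=> y a u v|move=> x a u v|move=> x; exact: cvg_cst];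
  by rewrite scaler0 addr0.
Qed.

Lemma bilin_mem_lin a f g : bilin_mem f -> bilin_mem g ->
  bilin_mem (fun x => a *: f x + g x).
Proof.
move=> [fl fr fc] [gl gr gc]; split.
- by move=> y b u v; rewrite fl gl !scalerDr !scalerA addrACA (mulrC a).
- by move=> y b u v; rewrite fr gr !scalerDr !scalerA addrACA (mulrC a).
- by move=> x; apply: cvgD; [apply: cvgZr; exact: fc|exact: gc].
Qed.

Lemma bilin_memZ f : bilin_mem f -> forall a x, f (a *: x) = a ^+ 2 *: f x.
Proof.
move=> [fl fr _] a [x y].
have f0l z : f (0, z) = 0.
  by have := fl z (-1) 0 0; rewrite scaler0 add0r scaleN1r addNr.
have f0r z : f (z, 0) = 0.
  by have := fr z (-1) 0 0; rewrite scaler0 add0r scaleN1r addNr.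
rewrite -[a *: (x, y)]/(a *: x, a *: y).
have := fl (a *: y) a x 0; rewrite !addr0 => ->; rewrite f0l addr0.
have := fr x a y 0; rewrite !addr0 => ->.
by rewrite f0r addr0 scalerA expr2.
Qed.

Lemma bilin_mem_f0 f : bilin_mem f -> f 0 = 0.
Proof.
by move=> fP; have := bilin_memZ fP 0 0; rewrite scaler0 expr0n scale0r.
Qed.

Definition lin_opspace : opspace V W := Opspace lin_mem0 lin_mem_lin
  (fun f fP => homogeneous_bounded (lin_mem_f0 fP) (lin_memZ fP) (fP.2 0))
  (fun f fP => homogeneous_eq0 (lin_memZ fP)).

Lemma bilin_mem_bounded f : bilin_mem f ->
  exists M, forall x, `|x| <= 1 -> `|f x| <= M.
Proof.
move=> fP; have [_ _ fc] := fP.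
exact: homogeneous_bounded (bilin_mem_f0 fP) (bilin_memZ fP) (fc 0).
Qed.

(* the norm of [V * V] is the maximum norm, hence the norm of [B] is
   the supremum of [`|B (x, y)|] for [`|x| <= 1] and [`|y| <= 1] *)
Definition bilin_opspace : opspace (V * V)%type W :=
  Opspace bilin_mem0 bilin_mem_lin bilin_mem_bounded
  (fun f fP => homogeneous_eq0 (bilin_memZ fP)).

End linear_bilinear.

(* continuous linear maps, and continuous bilinear maps *)
Notation "''L' ( V , W )" := (opmap (lin_opspace V W))
  (at level 8, format "''L' ( V ,  W )") : type_scope.
Notation "''L2' ( V , W )" := (opmap (bilin_opspace V W))
  (at level 8, format "''L2' ( V ,  W )") : type_scope.

(** * Subspaces of countable products of normed spaces *)

Record subprodspace (R : realType) (V : nat -> normedModType R) :=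
  Subprodspace {
    spmem :> (forall i, V i) -> Prop;
    spmem0 : spmem (fun=> 0);
    spmem_lin : forall (a : R) x y, spmem x -> spmem y ->
      spmem (fun i => a *: x i + y i) }.

Record subprod (R : realType) (V : nat -> normedModType R)
  (S : subprodspace V) := Subprod { spval :> forall i, V i; spvalP : S spval }.

Section subprod.
Context (R : realType) (V : nat -> normedModType R) (S : subprodspace V).
Implicit Types x y z : subprod S.

Lemma subprod_eq x y : (forall i, x i = y i) -> x = y.
Proof.
case: x y => [x xP] [y yP] /= xy.
have {}xy := functional_extensionality_dep xy; subst y.
by congr Subprod; exact: Prop_irrelevance.
Qed.

HB.instance Definition _ := gen_eqMixin (subprod S).
HB.instance Definition _ := gen_choiceMixin (subprod S).

Definition sp0 : subprod S := Subprod (spmem0 S).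

Definition splin (a : R) x y : subprod S :=
  Subprod (spmem_lin a (spvalP x) (spvalP y)).

Definition spadd x y := splin 1 x y.
Definition spscale a x := splin a x sp0.
Definition spopp x := spscale (-1) x.

Let spaddA : associative spadd.
Proof. by move=> f g h; apply: subprod_eq => x /=; rewrite !scale1r addrA. Qed.
Let spaddC : commutative spadd.
Proof. by move=> f g; apply: subprod_eq => x /=; rewrite !scale1r addrC. Qed.
Let spadd0 : left_id sp0 spadd.
Proof. by move=> f; apply: subprod_eq => x /=; rewrite !scale1r add0r. Qed.
Let spaddN : left_inverse sp0 spopp spadd.
Proof.
by move=> f; apply: subprod_eq => x /=; rewrite scale1r addr0 scaleN1r addNr.
Qed.

HB.instance Definition _ :=
  GRing.isZmodule.Build (subprod S) spaddA spaddC spadd0 spaddN.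

Lemma spaddE x y i : (x + y) i = x i + y i.
Proof. by rewrite /= scale1r. Qed.

Let spscaleA a b x : spscale a (spscale b x) = spscale (a * b) x.
Proof. by apply: subprod_eq => i /=; rewrite !addr0 scalerA. Qed.
Let spscale1 : left_id 1 spscale.
Proof. by move=> x; apply: subprod_eq => i /=; rewrite addr0 scale1r. Qed.
Let spscaleDr : right_distributive spscale +%R.
Proof.
by move=> a x y; apply: subprod_eq => i; rewrite /= !addr0 !scale1r scalerDr.
Qed.
Let spscaleDl x : {morph spscale^~ x : a b / a + b}.
Proof.
by move=> a b; apply: subprod_eq => i; rewrite /= !addr0 !scale1r scalerDl.
Qed.

HB.instance Definition _ := GRing.Zmodule_isLmodule.Build R (subprod S)
  spscaleA spscale1 spscaleDr spscaleDl.

Lemma spscaleE (a : R) x i : (a *: x) i = a *: x i.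
Proof. by rewrite /= addr0. Qed.

Definition sptuple x : prod_topology V := spval x.

HB.instance Definition _ :=
  Topological.copy (subprod S) (initial_topology sptuple).

Lemma subprod_cvgP (F : set_system (subprod S)) x : Filter F ->
  F --> x <-> forall i, (fun y => y i) @ F --> x i.
Proof.
move=> FF; split => [Fx i|Fx].
  have := @continuous_comp _ _ _ sptuple (@proj nat V i) x.
  move=> /(_ (@initial_continuous _ _ sptuple x)) /(_ (@proj_continuous _ _ i _)).
  by move=> h; apply: cvg_trans h; exact: cvg_app.
suff h : sptuple @ F --> sptuple x.
  move=> A [B [[C oC CB] Bx BA]].
  have Cx : nbhs (sptuple x) C.
    by apply: open_nbhs_nbhs; split=> //; move: Bx; rewrite -CB.
  have : F (sptuple @^-1` C) by exact: h.
  by apply: filterS => y Cy; apply: BA; rewrite -CB.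
have sF : Filter (sptuple @ F) := fmap_filter _ FF.
have [_] := @cvg_sup _ _ (fun i => Topological.class
  (initial_topology (fun f : (forall i, V i) => f i))) _ (spval x) sF.
apply=> i A [B [[C oC CB] Bx BA]].
have Cx : nbhs (x i) C.
  by apply: open_nbhs_nbhs; split=> //; move: Bx; rewrite -CB.
have FC : F [set y : subprod S | C (y i)] by exact: Fx.
have : F (sptuple @^-1` A); last by [].
by apply: filterS FC => y Cy; apply: BA; rewrite -CB.
Qed.

Lemma subprod_proj_continuous i : continuous (fun x : subprod S => x i).
Proof. move=> x; have /subprod_cvgP : nbhs x --> x by [].
exact.
Qed.

Lemma subprod_continuousP (T : topologicalType) (f : T -> subprod S) t :
  {for t, continuous f} <-> forall i, {for t, continuous (fun s => f s i)}.
Proof. exact: subprod_cvgP. Qed.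

Let spadd_continuous : continuous (fun p : subprod S * subprod S => p.1 + p.2).
Proof.
move=> p; apply/subprod_continuousP => i.
rewrite (_ : (fun s => _) = fun q : subprod S * subprod S => q.1 i + q.2 i).
  apply: cvgD.
    exact: (continuous_comp cvg_fst (@subprod_proj_continuous i p.1)).
  exact: (continuous_comp cvg_snd (@subprod_proj_continuous i p.2)).
by apply/funext => q; rewrite spaddE.
Qed.

Let spscale_continuous :
  continuous (fun p : R^o * subprod S => p.1 *: p.2).
Proof.
move=> p; apply/subprod_continuousP => i.
rewrite (_ : (fun s => _) = fun q : R^o * subprod S => q.1 *: q.2 i).
  apply: (@cvgZ _ _ _ _ _ (fun q : R^o * subprod S => q.1) (fun q => q.2 i)).
    exact: cvg_fst.
  exact: (continuous_comp cvg_snd (@subprod_proj_continuous i p.2)).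
by apply/funext => q; rewrite spscaleE.
Qed.

Lemma subprod_nbhsP x (A : set (subprod S)) :
  nbhs x A <-> exists n, exists2 e, 0 < e &
    forall y, (forall i, (i < n)%N -> `|x i - y i| < e) -> A y.
Proof.
pose B n (e : R) := [set y : subprod S | forall i, (i < n)%N -> `|x i - y i| < e].
pose F : set_system (subprod S) := [set A | exists n, exists2 e, 0 < e & B n e `<=` A].
have FF : Filter F.
  split; first by exists 0%N, 1.
    move=> P Q [n [e e0 P_]] [m [d d0 Q_]].
    exists (maxn n m), (Num.min e d); first by rewrite lt_min e0.
    move=> y h; split; [apply: P_|apply: Q_] => i ilt;
      have := h i; rewrite leq_max ilt ?orbT lt_min => /(_ isT) /andP[];
      by [].
  by move=> P Q PQ [n [e e0 P_]]; exists n, e => //; exact: subset_trans PQ.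
split; last first.
  move=> [n [e e0 BA]].
  suff : nbhs x (B n e) by apply: filterS => y; exact: BA.
  have : nbhs x [set y : subprod S | forall i : 'I_n, `|x i - y i| < e].
    apply: (@filter_forall _ _
      (fun (i : 'I_n) (y : subprod S) => `|x i - y i| < e)
      (nbhs x) (nbhs_filter x)) => i.
    by have /cvgrPdist_lt := @subprod_proj_continuous i x; exact.
  by apply: filterS => y h i ilt; exact: (h (Ordinal ilt)).
have : F --> x.
  apply/subprod_cvgP => i; apply/cvgrPdist_lt => e e0.
  exists i.+1, e => // y; exact.
by move=> h /h.
Qed.

Let subprod_locally_convex : exists2 B : set_system (subprod S),
  (forall b, b \in B -> convex_set b) & basis B.
Proof.
exists [set b | exists x n e,
    b = [set y : subprod S | forall i, (i < n)%N -> `|x i - y i| < e]].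
  move=> _ /set_mem[x [n [e ->]]].
  apply/convex_setW => y z; rewrite !inE/= => xy xz l l0 l1.
  rewrite inE => i ilt.
  have l0' : 0 < l%:num by [].
  rewrite (_ : conv l y z =
    l%:num *: (y : subprod S) + (1 - l%:num) *: (z : subprod S)); last by [].
  rewrite spaddE !spscaleE.
  have -> : x i - (l%:num *: y i + (1 - l%:num) *: z i) =
      l%:num *: (x i - y i) + (1 - l%:num) *: (x i - z i).
    by rewrite !scalerBr addrACA -scalerDl [l%:num + _]addrC subrK scale1r opprD.
  rewrite (le_lt_trans (ler_normD _ _))// !normrZ gtr0_norm//.
  rewrite [`|1 - _|]gtr0_norm ?subr_gt0//.
  rewrite (_ : e = l%:num * e + (1 - l%:num) * e); last first.
    by rewrite -mulrDl [l%:num + _]addrC subrK mul1r.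
  by rewrite ltrD// ltr_pM2l ?subr_gt0//; [exact: xy|exact: xz].
split.
  move=> _ [x [n [e ->]]]; rewrite openE => y /= xy.
  suff : nbhs y [set z : subprod S | forall i : 'I_n, `|x i - z i| < e].
    by apply: filterS => z h i ilt; exact: (h (Ordinal ilt)).
  apply: (@filter_forall _ _
    (fun (i : 'I_n) (z : subprod S) => `|x i - z i| < e)
    (nbhs y) (nbhs_filter y)) => i.
  have d0 : 0 < e - `|x i - y i| by rewrite subr_gt0 xy.
  have /cvgrPdist_lt /(_ _ d0) := @subprod_proj_continuous i y.
  apply: filterS => z /= yz; rewrite -(subrK (y i) (x i)) -addrA.
  by rewrite (le_lt_trans (ler_normD _ _))// -ltrBrDl.
move=> x A /subprod_nbhsP[n [e e0 xA]].
exists [set y : subprod S | forall i, (i < n)%N -> `|x i - y i| < e] => //.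
by split=> [|i _ /=]; [exists x, n, e|rewrite subrr normr0].
Qed.

HB.instance Definition _ := PreTopologicalLmod_isTvs.Build R (subprod S)
  spadd_continuous spscale_continuous subprod_locally_convex.
HB.instance Definition _ := PreTopologicalNmodule_isTopologicalNmodule.Build
  (subprod S) spadd_continuous.
HB.instance Definition _ := TopologicalNmodule_isTopologicalLmodule.Build
  R (subprod S) spscale_continuous.
HB.instance Definition _ := Uniform_isTvs.Build
  R (subprod S) subprod_locally_convex.

(* [x] as an element of the subspace, or the junk value 0 *)
Definition to_subprod (x : forall i, V i) : subprod S :=
  if pselect (S x) is left xS then Subprod xS else 0.

End subprod.

(** * Smooth maps *)

(* the Frechet derivative, as a map into the normed space [L(V, W)] *)
Definition Dmap (R : realType) (V W : normedModType R) (f : V -> W) (x : V) :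
  'L(V, W) := to_opmap (lin_opspace V W) ('d f x).

(* [U] is meant to be open *)
Fixpoint Ck (R : realType) (V : normedModType R) (n : nat) :
    forall W : normedModType R, set V -> (V -> W) -> Prop :=
  match n with
  | 0 => fun W U f => {in U, continuous f}
  | n'.+1 => fun W U f => (forall x, U x -> differentiable f x) /\
                          Ck n' U (Dmap f)
  end.

Definition smooth_on (R : realType) (V W : normedModType R)
  (U : set V) (f : V -> W) := forall n, Ck n U f.

(* directional derivative; stated as a relation because the library's ['D_v f]
   is restricted to normed spaces *)
Definition has_dirderiv (R : realType) (V W : tvsType R) (f : V -> W)
    (x v : V) (w : W) : Prop :=
  (fun h : R => h^-1 *: (f (x + h *: v) - f x)) @ 0^' --> w.

(* Smoothness between locally convex spaces that need not be normed
   (Michal-Bastiani, Hamilton): all iterated directional derivatives exist and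
   are jointly continuous. *)
Fixpoint lcCk (R : realType) (n : nat) :
    forall V W : tvsType R, set V -> (V -> W) -> Prop :=
  match n with
  | 0 => fun V W U f => {in U, continuous f}
  | n'.+1 => fun V W U f => {in U, continuous f} /\
      exists df : V * V -> W,
        (forall x v, U x -> has_dirderiv f x v (df (x, v))) /\
        lcCk n' (U `*` setT) df
  end.

Definition lc_smooth_on (R : realType) (V W : tvsType R)
  (U : set V) (f : V -> W) := forall n, lcCk n U f.

(** * Banach manifolds *)

(* [g \o f^-1], where [f^-1] is the inverse of [f] restricted to [D], on which
   [f] is meant to be injective; its value off [f @` D] is 0. *)
Definition local_rep (R : realType) (T U : Type) (W : lmodType R)
    (D : set T) (f : T -> U) (g : T -> W) (u : U) : W :=
  xget 0 [set g x | x in [set x | D x /\ f x = u]].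

(* The values of a chart outside its domain are irrelevant. *)
Record chart (R : realType) (T : topologicalType) (E : normedModType R) :=
  Chart {
    dom : set T;
    chart_map :> T -> E;
    dom_open : open dom;
    chart_inj : {in dom &, injective chart_map};
    chart_continuous : {in dom, continuous chart_map};
    chart_open : forall V, open V -> V `<=` dom -> open (chart_map @` V) }.

Section charts.
Context (R : realType) (T : topologicalType) (E : normedModType R).
Implicit Types c d : chart T E.

(* the map [g : T -> W] read in the chart [c] *)
Definition in_chart (W : lmodType R) c (g : T -> W) : E -> W :=
  local_rep (dom c) c g.

Definition chart_image c : set E := c @` dom c.

Definition transition c d : E -> E := in_chart c d.

Definition compatible c d : Prop :=
  smooth_on (c @` (dom c `&` dom d)) (transition c d) /\
  smooth_on (d @` (dom c `&` dom d)) (transition d c).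

End charts.

Record banachManifold (R : realType) (E : completeNormedModType R) :=
  BanachManifold {
    carrier :> topologicalType;
    atlas : set (chart carrier E);
    atlas_cover : forall x, exists2 c, atlas c & dom c x;
    atlas_compatible : forall c d, atlas c -> atlas d -> compatible c d;
    atlas_maximal : forall c,
      (forall d, atlas d -> compatible c d) -> atlas c }.

Definition smooth_map (R : realType) (E F : completeNormedModType R)
    (M : banachManifold E) (N : banachManifold F) (f : M -> N) : Prop :=
  continuous f /\
  forall (c : chart M E) (d : chart N F), atlas c -> atlas d ->
    smooth_on (c @` (dom c `&` f @^-1` dom d)) (in_chart c (d \o f)).

(* A tangent vector is given by its coordinates in the charts around the point;
   its components in the other charts are set to 0. *)
Record tangent (R : realType) (E : completeNormedModType R)
    (M : banachManifold E) (x : M) := Tangent {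
  coords :> chart M E -> E;
  coords_transition : forall c d, atlas c -> atlas d -> dom c x -> dom d x ->
    coords d = 'd (transition c d) (c x) (coords c);
  coords_out : forall c, ~ (atlas c /\ dom c x) -> coords c = 0 }.

(* [Tf . v = w], where [y = f x] *)
Definition tangent_map_rel (R : realType) (E F : completeNormedModType R)
    (M : banachManifold E) (N : banachManifold F) (f : M -> N)
    (x : M) (y : N) (v : tangent x) (w : tangent y) : Prop :=
  y = f x /\
  forall (c : chart M E) (d : chart N F), atlas c -> atlas d ->
    dom c x -> dom d y -> w d = 'd (in_chart c (d \o f)) (c x) (v c).

Section vector_fields.
Context (R : realType) (E : completeNormedModType R) (M : banachManifold E).

Definition principal (X : forall x : M, tangent x) (c : chart M E) : E -> E :=
  in_chart c (fun x => X x c).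

Record vfield := Vfield {
  vf :> forall x : M, tangent x;
  vf_smooth : forall c, atlas c -> smooth_on (chart_image c) (principal vf c) }.

(* [G] is a local expression (Christoffel symbol) of [nabla] in [c] *)
Definition christoffel (nabla : vfield -> vfield -> vfield) (c : chart M E)
    (G : E -> 'L2(E, E)) : Prop :=
  smooth_on (chart_image c) G /\
  forall (X Y : vfield) u, chart_image c u ->
    principal (nabla X Y) c u =
      'd (principal Y c) u (principal X c u)
      - G u (principal X c u, principal Y c u).

Definition is_connection (nabla : vfield -> vfield -> vfield) : Prop :=
  forall c, atlas c -> exists G, christoffel nabla c G.

End vector_fields.

(** * Projective systems *)

Record banachSystem (R : realType) := BanachSystem {
  space :> nat -> completeNormedModType R;
  rho : forall i j, (i <= j)%N -> {linear space j -> space i};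
  rho_continuous : forall i j (ij : (i <= j)%N), continuous (rho ij);
  rho_id : forall i (ii : (i <= i)%N) x, rho ii x = x;
  rho_comp : forall i j k (ij : (i <= j)%N) (jk : (j <= k)%N) (ik : (i <= k)%N)
    x, rho ij (rho jk x) = rho ik x }.

Section limit_spaces.
Context (R : realType) (E : banachSystem R).

Definition coherent (x : forall i, E i) : Prop :=
  forall i j (ij : (i <= j)%N), rho E ij (x j) = x i.

Lemma coherent0 : coherent (fun=> 0).
Proof. by move=> i j ij; rewrite linear0. Qed.

Lemma coherent_lin (a : R) x y : coherent x -> coherent y ->
  coherent (fun i => a *: x i + y i).
Proof. by move=> xP yP i j ij; rewrite linearP xP yP. Qed.

Definition frechet_space := Subprodspace coherent0 coherent_lin.
Definition frechet_limit := subprod frechet_space.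

HB.instance Definition _ := Tvs.copy frechet_limit (subprod frechet_space).

Definition coherent2 (B : forall i, 'L2(E i, E i)) : Prop :=
  forall i j (ij : (i <= j)%N) x y,
    B i (rho E ij x, rho E ij y) = rho E ij (B j (x, y)).

Lemma coherent20 : coherent2 (fun=> 0).
Proof. by move=> i j ij x y; rewrite linear0. Qed.

Lemma coherent2_lin (a : R) B C : coherent2 B -> coherent2 C ->
  coherent2 (fun i => a *: B i + C i).
Proof.
move=> BP CP i j ij x y.
by rewrite !opaddE !opscaleE BP CP linearP.
Qed.

Definition H2_space := Subprodspace coherent20 coherent2_lin.
Definition H2 := subprod H2_space.

HB.instance Definition _ := Tvs.copy H2 (subprod H2_space).

Definition to_limit (x : forall i, E i) : frechet_limit := to_subprod _ x.

Definition H2_app (B : H2) (x y : frechet_limit) : frechet_limit :=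
  to_limit (fun i => B i (x i, y i)).

End limit_spaces.

Record manifoldSystem (R : realType) (E : banachSystem R) := ManifoldSystem {
  mfd :> forall i, banachManifold (E i);
  phi : forall i j, (i <= j)%N -> mfd j -> mfd i;
  phi_smooth : forall i j (ij : (i <= j)%N), smooth_map (phi ij);
  phi_id : forall i (ii : (i <= i)%N) x, phi ii x = x;
  phi_comp : forall i j k (ij : (i <= j)%N) (jk : (j <= k)%N) (ik : (i <= k)%N)
    x, phi ij (phi jk x) = phi ik x }.

Arguments phi {R E} m {i j}.

Section limit_manifold.
Context (R : realType) (E : banachSystem R) (M : manifoldSystem E).

Record proj_limit := ProjLimit {
  pt :> forall i, M i;
  pt_coherent : forall i j (ij : (i <= j)%N), phi M ij (pt j) = pt i }.

HB.instance Definition _ := gen_eqMixin proj_limit.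
HB.instance Definition _ := gen_choiceMixin proj_limit.

Definition limit_tuple (m : proj_limit) : prod_topology (fun i => M i) := pt m.

HB.instance Definition _ :=
  Topological.copy proj_limit (initial_topology limit_tuple).

Section limit_chart.
Variable c : forall i, chart (M i) (E i).

Definition lim_dom : set proj_limit := [set m | forall i, dom (c i) (m i)].

Definition lim_chart_map (m : proj_limit) : frechet_limit E :=
  to_limit (fun i => c i (m i)).

Definition lim_chart_image : set (frechet_limit E) := lim_chart_map @` lim_dom.

Record is_limit_chart : Prop := IsLimitChart {
  lim_atlas : forall i, atlas (c i);
  lim_dom_phi : forall i j (ij : (i <= j)%N) x,
    dom (c j) x -> dom (c i) (phi M ij x);
  lim_chart_phi : forall i j (ij : (i <= j)%N) x,
    dom (c j) x -> c i (phi M ij x) = rho E ij (c j x);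
  lim_dom_neq0 : lim_dom !=set0;
  lim_dom_open : open lim_dom;
  lim_chart_image_open : open lim_chart_image }.

End limit_chart.

Definition has_limit_charts : Prop :=
  forall m : proj_limit, exists c, is_limit_chart c /\ lim_dom c m.

(* the fibre at [m] of the limit of the tangent bundles *)
Record ltangent (m : proj_limit) := Ltangent {
  lt :> forall i, tangent (m i);
  lt_coherent : forall i j (ij : (i <= j)%N),
    tangent_map_rel (phi M ij) (lt j) (lt i) }.

(* The relation [T(phi) \o X_j = X_i \o phi] is required at the points of [M j]
   lying in projective limit charts, that is, at all points of [M j] when these
   charts cover [M j]. At the remaining points of [M j] the connections of [M i]
   and [M j] are not compared, so that covariant derivatives of related fields
   need not be related there. *)
Definition related (X : forall i, vfield (M i)) : Prop :=
  forall c, is_limit_chart c -> forall i j (ij : (i <= j)%N) x,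
    dom (c j) x -> tangent_map_rel (phi M ij) (X j x) (X i (phi M ij x)).

Definition is_vlimit (X : forall i, vfield (M i))
    (Z : forall m, ltangent m) : Prop :=
  related X /\ forall m i, Z m i = X i (m i).

Record lvfield := Lvfield {
  lvf :> forall m, ltangent m;
  lvf_limit : exists X, is_vlimit X lvf }.

Definition lprincipal (X : lvfield) (c : forall i, chart (M i) (E i)) :
    frechet_limit E -> frechet_limit E :=
  local_rep (lim_dom c) (lim_chart_map c)
    (fun m => to_limit (fun i => X m i (c i))).

(* [G = lim G_i] for smooth [G_i], [G] is smooth, and is a local expression of
   [nabla] in the projective limit chart [c] *)
Definition lchristoffel (nabla : lvfield -> lvfield -> lvfield)
    (c : forall i, chart (M i) (E i)) (G : frechet_limit E -> H2 E) : Prop :=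
  [/\ exists2 Gi : forall i, E i -> 'L2(E i, E i),
        (forall i, smooth_on (chart_image (c i)) (Gi i)) &
        (forall u, lim_chart_image c u -> forall i, G u i = Gi i (u i)),
      lc_smooth_on (lim_chart_image c) G &
      forall (X Y : lvfield) u, lim_chart_image c u ->
        exists2 DYX, has_dirderiv (lprincipal Y c) u (lprincipal X c u) DYX &
          lprincipal (nabla X Y) c u =
            DYX - H2_app (G u) (lprincipal X c u) (lprincipal Y c u)].

Definition is_limit_connection (nabla : lvfield -> lvfield -> lvfield) : Prop :=
  forall c, is_limit_chart c -> exists G, lchristoffel nabla c G.

Implicit Type nabla : forall i, vfield (M i) -> vfield (M i) -> vfield (M i).

(* A Banach manifold may have too few global vector fields for the connection to
   determine its Christoffel symbols: the condition is then that compatible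
   ones exist. *)
Definition projective_connections nabla : Prop :=
  forall c, is_limit_chart c ->
  exists2 G : forall i, E i -> 'L2(E i, E i),
    (forall i, christoffel (nabla i) (c i) (G i)) &
    forall i j (ij : (i <= j)%N) u, chart_image (c j) u -> forall x y,
      rho E ij (G j u (x, y)) =
        G i (rho E ij u) (rho E ij x, rho E ij y).

Definition connection_limit nabla
    (lnabla : lvfield -> lvfield -> lvfield) : Prop :=
  forall (X Y : lvfield) (Xi Yi : forall i, vfield (M i)),
    is_vlimit Xi X -> is_vlimit Yi Y ->
    is_vlimit (fun i => nabla i (Xi i) (Yi i)) (lnabla X Y).

End limit_manifold.

(* Main.v *)
Require Import Defs.
From mathcomp Require Import all_boot all_order all_algebra.
From mathcomp Require Import all_classical all_reals all_analysis.

(** Why the theorem holds. In projective limit charts everything is computed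
    component by component, and three points need an argument.

    - The fields nabla_i X_i Y_i form a projective system. In limit charts the
      connecting map from M_j to M_i is the continuous linear map rho, which is
      its own differential ([limit_chart_tangent_map]; the relation between
      tangent vectors may be tested in one pair of charts by the chain rule,
      [tangent_map_relI]). Differentiating Y_i o rho = rho o Y_j gives
      DY_i(rho u).(rho v) = rho (DY_j(u).v) ([related_diff]), and the Christoffel
      symbols are compatible by assumption, so both terms of the local formula
      are carried by rho from level j to level i ([connection_related]).

    - The limit of nabla_i X_i Y_i depends only on X = lim X_i and Y = lim Y_i,
      although the points of M need not fill a neighbourhood in M_i. The local
      formula involves Y_i only through its value at a point of M and through
      its derivative in the direction of X_i. This direction is the i-th
      coordinate of a vector of the limit space F, and the image of a limit chart
      is open in F, so the derivative is a limit of difference quotients of Y_i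
      taken at points of M, hence of difference quotients of Y
      ([lprincipal_dirderiv], [connection_vlimit_unique]).

    - The limit G of the Christoffel symbols G_i is smooth from an open subset
      of F to H^2(F, F). Frechet differentiability of all orders implies
      existence and joint continuity of all iterated directional derivatives
      ([Ck_lcCk]); precomposed with the continuous linear projections of F the
      G_i thus give smooth components of G; finally a map into a closed linear
      subspace of a product is smooth when its components are ([lcCk_subprod]),
      and both F and H^2(F, F) are such subspaces ([frechet_space_closed],
      [H2_space_closed]).

    The local formula for the limit is then the sequence of the local formulas
    at all levels ([connection_limit_is_connection]). *)

Set Implicit Arguments.
Unset Strict Implicit.
Unset Printing Implicit Defensive.

Import Order.TTheory GRing.Theory Num.Theory.
Import numFieldNormedType.Exports.

Local Open Scope classical_set_scope.
Local Open Scope ring_scope.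

(** * Convergence and directional derivatives in topological vector spaces *)

Lemma cvg_pair_comp (T : Type) (A B W : topologicalType) (F : set_system T)
    {FF : Filter F} (k : A * B -> W) (f : T -> A) (g : T -> B) (a : A) (b : B) :
  {for (a, b), continuous k} -> f @ F --> a -> g @ F --> b ->
  (fun t => k (f t, g t)) @ F --> k (a, b).
Proof.
move=> ck fa gb.
by apply: (@cvg_comp _ _ _ (fun t => (f t, g t)) k F (nbhs (a, b))) ck;
  exact: cvg_pair.
Qed.

Lemma tvs_cvgD (R : realType) (W : tvsType R) (T : Type) (F : set_system T)
    {FF : Filter F} (f g : T -> W) (a b : W) :
  f @ F --> a -> g @ F --> b -> (fun t => f t + g t) @ F --> a + b.
Proof. exact: (cvg_pair_comp (@add_continuous W (a, b))). Qed.

Lemma cvg_line (R : realType) (V : tvsType R) (x v : V) :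
  (fun h : R => x + h *: v) @ 0^' --> x.
Proof.
rewrite -[X in _ --> X]addr0; apply: tvs_cvgD; first exact: cvg_cst.
rewrite -(scale0r v).
apply: (cvg_pair_comp (@scale_continuous R V ((0 : R^o), v))).
  exact: nbhs_dnbhs.
exact: cvg_cst.
Qed.

Lemma near_line (R : realType) (V : tvsType R) (U : set V) (x v : V) :
  open U -> U x -> \forall h \near (0 : R)^', U (x + h *: v).
Proof. by move=> oU Ux; exact: cvg_line (open_nbhs_nbhs (conj oU Ux)). Qed.

Lemma near_eq_cvg_to (T : Type) (W : nbhsType) (F : set_system T) {FF : Filter F}
    (f g : T -> W) (w : W) :
  (\forall t \near F, f t = g t) -> f @ F --> w -> g @ F --> w.
Proof. by move=> fg; apply: cvg_trans; exact: near_eq_cvg. Qed.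

Lemma has_dirderiv_congr (R : realType) (V W : tvsType R) (U : set V)
    (f g : V -> W) (x v : V) (w : W) :
  open U -> (forall y, U y -> f y = g y) -> U x ->
  has_dirderiv f x v w -> has_dirderiv g x v w.
Proof.
move=> oU fg Ux; apply: near_eq_cvg_to.
by apply: filterS (near_line v oU Ux) => h Uh; rewrite !fg.
Qed.

(** * Smooth maps between locally convex spaces *)

Lemma lcCk_continuous (R : realType) n (V W : tvsType R) (U : set V)
  (f : V -> W) : lcCk n U f -> {in U, continuous f}.
Proof. by case: n => // n []. Qed.

Lemma lcCk_le (R : realType) n (V W : tvsType R) (U : set V) (f : V -> W) :
  lcCk n.+1 U f -> lcCk n U f.
Proof.
elim: n V W U f => [V W U f []//|n IHn V W U f [cf [df [fdf dfC]]]].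
by split=> //; exists df; split=> //; exact: IHn.
Qed.

Lemma lcCk_congr (R : realType) n (V W : tvsType R) (U : set V) (f g : V -> W) :
  open U -> (forall x, U x -> f x = g x) -> lcCk n U f -> lcCk n U g.
Proof.
move=> oU fg.
have congr0 : {in U, continuous f} -> {in U, continuous g}.
  move=> cf x xU; have Ux := set_mem xU; rewrite /continuous_at -fg//.
  apply: near_eq_cvg_to (cf x xU).
  by apply: filterS fg _; exact: open_nbhs_nbhs.
case: n => [|n]; first exact: congr0.
case=> cf [df [fdf dfC]]; split; first exact: congr0.
exists df; split=> // x v Ux.
exact: has_dirderiv_congr oU fg Ux (fdf x v Ux).
Qed.

(** As [l] is linear, the derivative of [f \o l] is [df] precomposed with
    [(l, l)], again a continuous linear map: this makes the induction work. *)
Lemma lcCk_comp_linear (R : realType) n (V' V W : tvsType R) (l : V' -> V)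
    (U' : set V') (U : set V) (f : V -> W) :
  linear l -> continuous l -> (forall x, U' x -> U (l x)) ->
  lcCk n U f -> lcCk n U' (f \o l).
Proof.
have comp0 (V1 V2 W2 : tvsType R) (k : V1 -> V2) (U1 : set V1) (U2 : set V2)
    (g : V2 -> W2) : continuous k -> (forall x, U1 x -> U2 (k x)) ->
    {in U2, continuous g} -> {in U1, continuous (g \o k)}.
  move=> ck kU cg x xU; apply: continuous_comp; first exact: ck.
  by apply: cg; apply/mem_set/kU/set_mem.
elim: n V' V W l U' U f => [|n IHn] V' V W l U' U f ll cl lU.
  exact: comp0.
case=> cf [df [fdf dfC]]; split; first exact: comp0 cl lU cf.
have lD a x y : l (x + a *: y) = l x + a *: l y by rewrite addrC ll addrC.
exists (df \o (fun p => (l p.1, l p.2))); split.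
  move=> x v /lU Ux; rewrite /has_dirderiv /=.
  under eq_fun do rewrite lD.
  exact: fdf.
apply: IHn dfC.
- by move=> a [x v] [y w] /=; rewrite !ll.
- move=> p; apply: cvg_pair.
    exact: continuous_comp cvg_fst (cl _).
  exact: continuous_comp cvg_snd (cl _).
- by move=> p [/lU Ux _].
Qed.

Lemma lcCkD (R : realType) n (V W : tvsType R) (U : set V) (f g : V -> W) :
  lcCk n U f -> lcCk n U g -> lcCk n U (fun x => f x + g x).
Proof.
elim: n V W U f g => [|n IHn] V W U f g.
  by move=> cf cg x xU; apply: tvs_cvgD; [exact: cf|exact: cg].
case=> cf [df [fdf dfC]] [cg [dg [gdg dgC]]].
split; first by move=> x xU; apply: tvs_cvgD; [exact: cf|exact: cg].
exists (fun p => df p + dg p); split; last exact: IHn.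
move=> x v Ux; apply: near_eq_cvg_to (tvs_cvgD (fdf x v Ux) (gdg x v Ux)).
near=> h.
by rewrite -scalerDr addrACA -opprD.
Unshelve. all: by end_near. Qed.

Lemma lcCk_linear (R : realType) n (V W : tvsType R) (U : set V) (l : V -> W) :
  linear l -> continuous l -> lcCk n U l.
Proof.
elim: n V W U l => [|n IHn] V W U l ll cl; first by move=> x _; exact: cl.
split; first by move=> x _; exact: cl.
exists (l \o snd); split; last first.
  apply: IHn => [a x y|x]; first exact: ll.
  exact: continuous_comp cvg_snd (cl _).
move=> x v _; apply: near_eq_cvg_to (cvg_cst (l v)).
near=> h; have h0 : h != 0 by near: h; exact: nbhs_dnbhs_neq.
by rewrite [x + _]addrC ll addrK scalerA mulVf// scale1r.
Unshelve. all: by end_near. Qed.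

(** By the Leibniz rule the derivative is a sum of two terms of the same form,
    each with one factor differentiated and the other one merely precomposed
    with the first projection; the latter loses one order by [lcCk_le]. *)
Lemma lcCk_bilinear (R : realType) n (V A B W : tvsType R) (b : A * B -> W)
    (U : set V) (f : V -> A) (g : V -> B) :
  (forall y, linear (fun x => b (x, y))) ->
  (forall x, linear (fun y => b (x, y))) -> continuous b ->
  lcCk n U f -> lcCk n U g -> lcCk n U (fun x => b (f x, g x)).
Proof.
move=> bl br cb; elim: n V U f g => [|n IHn] V U f g.
  move=> cf cg x xU; apply: continuous_comp (cb _).
  by apply: cvg_pair; [exact: cf|exact: cg].
move=> fC gC; have [cf [df [fdf dfC]]] := fC.
have [cg [dg [gdg dgC]]] := gC.
have fstU (x : V * V) : (U `*` setT) x -> U x.1 by case.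
have fst_lin : linear (@fst V V) by move=> a x y.
have fst_cont : continuous (@fst V V) by move=> x; exact: cvg_fst.
split.
  move=> x xU; apply: continuous_comp (cb _).
  by apply: cvg_pair; [exact: cf|exact: cg].
exists (fun p => b (df p, g p.1) + b (f p.1, dg p)); split; last first.
  apply: lcCkD; apply: IHn => //.
    exact: lcCk_comp_linear fst_lin fst_cont fstU (lcCk_le gC).
  exact: lcCk_comp_linear fst_lin fst_cont fstU (lcCk_le fC).
move=> x v Ux.
have bZl a u w : b (a *: u, w) = a *: b (u, w).
  have b0 : b (0, w) = 0.
    by have := bl w (-1) 0 0; rewrite scaler0 add0r scaleN1r addNr.
  by have := bl w a u 0; rewrite b0 !addr0.
have bZr a u w : b (u, a *: w) = a *: b (u, w).
  have b0 : b (u, 0) = 0.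
    by have := br u (-1) 0 0; rewrite scaler0 add0r scaleN1r addNr.
  by have := br u a w 0; rewrite b0 !addr0.
have bBl u u' w : b (u - u', w) = b (u, w) - b (u', w).
  by have := bl w (-1) u' u; rewrite !scaleN1r [- u' + u]addrC => ->; rewrite addrC.
have bBr u w w' : b (u, w - w') = b (u, w) - b (u, w').
  by have := br u (-1) w' w; rewrite !scaleN1r [- w' + w]addrC => ->; rewrite addrC.
have gx : (fun h : R => g (x + h *: v)) @ 0^' --> g x.
  exact: cvg_comp _ _ (@cvg_line _ _ x v) (cg x (mem_set Ux)).
(* The difference quotient of the product, with [g] shifted in the first
   term, so that continuity of [b] gives the limit at once. *)
have q : (fun h : R => b (h^-1 *: (f (x + h *: v) - f x), g (x + h *: v)) +
    b (f x, h^-1 *: (g (x + h *: v) - g x))) @ 0^' -->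
    b (df (x, v), g x) + b (f x, dg (x, v)).
  apply: tvs_cvgD; first exact: cvg_pair_comp (@cb _) (fdf x v Ux) gx.
  exact: cvg_pair_comp (@cb _) (cvg_cst _) (gdg x v Ux).
apply: near_eq_cvg_to q; near=> h.
by rewrite bZl bZr -scalerDr bBl bBr addrA subrK.
Unshelve. all: by end_near. Qed.

(** * Comparison with Frechet differentiability *)

Lemma differentiable_has_dirderiv (R : realType) (V W : normedModType R)
    (f : V -> W) (x v : V) :
  differentiable f x -> has_dirderiv f x v ('d f x v).
Proof.
move=> fx; have := diff_derivable (v := v) fx; rewrite -deriveE//.
rewrite /derivable /derive /has_dirderiv => /cvg_ex[l fl].
rewrite (cvg_lim _ fl)//; apply: near_eq_cvg_to fl; near=> h.
by rewrite /= [h *: v + x]addrC.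
Unshelve. all: by end_near. Qed.

Lemma DmapE (R : realType) (V W : normedModType R) (f : V -> W) (x v : V) :
  differentiable f x -> Dmap f x v = 'd f x v.
Proof.
move=> fx; rewrite /Dmap /to_opmap; case: pselect => // -[].
by split; [exact: linearP|exact: diff_continuous].
Qed.

(** By scaling to the unit ball. Linear maps have degree 1, and bilinear maps
    have degree 2 as functions of the pair of their arguments. *)
Lemma opnorm_homogeneous (R : realType) (V W : normedModType R)
    (S : opspace V W) (n : nat) (f : opmap S) (v : V) :
  (forall a x, f (a *: x) = a ^+ n *: f x) -> `|f v| <= `|f| * `|v| ^+ n.
Proof.
move=> fZ; have [->|v0] := eqVneq v 0.
  case: n fZ => [|n] fZ.
    by rewrite expr0 mulr1; apply: opnorm_ub; rewrite normr0.
  by rewrite -[X in f X](scale0r 0) fZ expr0n scale0r !normr0 expr0n mulr0.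
have nv : 0 < `|v| by rewrite normr_gt0.
have := @opnorm_ub _ _ _ _ f (`|v|^-1 *: v).
rewrite fZ !normrZ normfV normr_id mulVf ?gt_eqF// => /(_ (lexx _)).
by rewrite normrX normfV normr_id exprVn ler_pdivrMl ?exprn_gt0// mulrC.
Qed.

Lemma eval_continuous (R : realType) (V W : normedModType R) :
  continuous (fun p : 'L(V, W) * V => p.1 p.2).
Proof.
move=> [f v]; have fc : continuous f by have [] := opfunP f.
rewrite /continuous_at -[X in _ --> X]addr0.
(* [g w - f v = f (w - v) + (g - f) w], the last term being bounded by
   [`|g - f| * `|w|]. *)
have -> : (fun p : 'L(V, W) * V => p.1 p.2) =
    (fun p : 'L(V, W) * V => f p.2) \+ (fun p => (p.1 - f) p.2).
  apply/funext => p; rewrite -[RHS]/(f p.2 + (p.1 - f) p.2) -opaddE.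
  by rewrite [f + _]addrC subrK.
apply: cvgD.
  exact: (cvg_comp (fun p : 'L(V, W) * V => p.2) f cvg_snd (fc v)).
apply/norm_cvg0P.
apply: (@squeeze_cvgr _ _ _ _ (fun=> 0)
  (fun p : 'L(V, W) * V => `|p.1 - f| * `|p.2|)).
- near=> p; rewrite normr_ge0 /= -[`|p.2|]expr1.
  exact: (opnorm_homogeneous _ (lin_memZ (opfunP (p.1 - f)))).
- exact: cvg_cst.
rewrite -[X in _ --> X](mul0r `|v|) -[X in X * _](normr0 'L(V, W)).
rewrite -[X in `|X| * _](subrr f).
apply: cvgM; last by apply: cvg_norm; exact: cvg_snd.
by apply: cvg_norm; apply: cvgB; [exact: cvg_fst|exact: cvg_cst].
Unshelve. all: by end_near. Qed.

(** The directional derivative of [f] is the evaluation of [Dmap f], a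
    bilinear expression in [Dmap f] and the direction. *)
Lemma Ck_lcCk (R : realType) n (V W : normedModType R) (U : set V)
  (f : V -> W) : Ck n U f -> lcCk n U f.
Proof.
elim: n W f => [//|n IHn] W f [fd /IHn DfC]; split.
  by move=> x /set_mem/fd; exact: differentiable_continuous.
exists (fun p => Dmap f p.1 p.2); split.
  by move=> x v /fd fx; rewrite /= DmapE//; exact: differentiable_has_dirderiv.
apply: (@lcCk_bilinear _ _ _ _ _ _ (fun q : 'L(V, W) * V => q.1 q.2) _
  (Dmap f \o fst) snd).
- by move=> v a g h; rewrite opaddE opscaleE.
- by move=> g; have [] := opfunP g.
- exact: eval_continuous.
- by apply: lcCk_comp_linear DfC => // [|p []//]; move=> p; exact: cvg_fst.
- by apply: lcCk_linear => // p; exact: cvg_snd.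
Qed.

(** * Smoothness into a closed subspace of a product *)

Lemma openXT (X Y : topologicalType) (U : set X) :
  open U -> open (U `*` (setT : set Y)).
Proof.
move=> oU; rewrite setXT.
by apply: open_comp => // p _; exact: cvg_fst.
Qed.

(** Closedness for the product topology, stated by filters. *)
Definition spclosed (R : realType) (V : nat -> normedModType R)
    (S : subprodspace V) : Prop :=
  forall (F : set_system (subprod S)) (x : forall i, V i), ProperFilter F ->
    (forall i, (fun y : subprod S => y i) @ F --> x i) -> S x.

Lemma to_subprodE (R : realType) (V : nat -> normedModType R)
    (S : subprodspace V) (x : forall i, V i) i :
  S x -> to_subprod S x i = x i.
Proof. by move=> Sx; rewrite /to_subprod; case: pselect. Qed.

Lemma spsubE (R : realType) (V : nat -> normedModType R)
    (S : subprodspace V) (x y : subprod S) i : (x - y) i = x i - y i.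
Proof. by rewrite spaddE -scaleN1r spscaleE scaleN1r. Qed.

(** The difference quotients lie in [S], which is closed, so a limit computed
    in each component lies in [S] as well. *)
Lemma has_dirderiv_subprod (R : realType) (V : nat -> normedModType R)
    (S : subprodspace V) (X : tvsType R) (f : X -> subprod S) (x v : X)
    (w : forall i, V i) : spclosed S ->
  (forall i, has_dirderiv (fun y => f y i) x v (w i)) ->
  S w /\ has_dirderiv f x v (to_subprod S w).
Proof.
move=> cS fw.
pose q (h : R) : subprod S := h^-1 *: (f (x + h *: v) - f x).
have qi i : (fun h => q h i) @ 0^' --> w i.
  apply: near_eq_cvg_to (fw i); near=> h.
  by rewrite spscaleE spsubE.
have Sw : S w by apply: (cS (q @ 0^')) => i; exact: qi.
by split=> //; apply/subprod_cvgP => i; rewrite to_subprodE//; exact: qi.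
Unshelve. all: by end_near. Qed.

(** The componentwise derivatives assemble, by closedness of [S], to a map into
    [S]; off [U] the junk value of [to_subprod] is harmless because smoothness
    on an open set is a local property. *)
Lemma lcCk_subprod (R : realType) n (V : nat -> normedModType R)
    (S : subprodspace V) (X : tvsType R) (U : set X) (f : X -> subprod S) :
  spclosed S -> open U -> (forall i, lcCk n U (fun x => f x i)) -> lcCk n U f.
Proof.
move=> cS; elim: n X U f => [|n IHn] X U f oU fC.
  by move=> x xU; apply/subprod_continuousP => i; exact: fC.
split.
  move=> x xU; apply/subprod_continuousP => i.
  exact: (lcCk_continuous (fC i)).
have /(_ _)/cid-/all_tag[df dfP] : forall i, exists df, (forall x v, U x ->
    has_dirderiv (fun x => f x i) x v (df (x, v))) /\
    lcCk n (U `*` setT) df by move=> i; have [_] := fC i.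
have dfS x v Ux := has_dirderiv_subprod cS
  (fun i => (dfP i).1 x v Ux) (w := fun i => df i (x, v)).
exists (fun p => to_subprod S (fun i => df i p)); split.
  by move=> x v Ux; have [] := dfS x v Ux.
have oUT : open (U `*` (setT : set X)) by exact: openXT.
apply: IHn => // i; apply: (lcCk_congr oUT) ((dfP i).2) => -[x v] [/= Ux _].
by rewrite to_subprodE//; have [] := dfS x v Ux.
Qed.

(** * Tangent maps in charts *)

Lemma near_eq_diff (R : realType) (V W : normedModType R) (f g : V -> W) (x : V) :
  (\forall y \near x, f y = g y) -> differentiable f x ->
  differentiable g x /\ 'd g x = 'd f x :> (V -> W).
Proof.
move=> fg df.
have gE : g \o shift x = cst (g x) + 'd f x +o_ 0 id.
  have /eqaddoP fo := diff_locally df.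
  apply/eqaddoP => e e0; have := fo _ e0.
  have : \forall h \near (0 : V), f (h + x) = g (h + x).
    suff sx : (fun h : V => h + x) @ 0 --> x by exact: sx fg.
    rewrite -[X in _ --> X]add0r; apply: cvgD; [exact: cvg_id|exact: cvg_cst].
  apply: filterS2 => h /= fgh; rewrite /= -(nbhs_singleton fg).
  by rewrite !fctE /= fgh.
have dgE : 'd g x = 'd f x :> (V -> W).
  by apply: diff_unique => //; exact: diff_continuous.
split=> //; apply/diff_locallyP; rewrite dgE; split=> //.
exact: diff_continuous.
Qed.

Lemma local_repE (R : realType) (T U : Type) (W : lmodType R) (D : set T)
    (f : T -> U) (g : T -> W) (x : T) :
  (forall y z, D y -> D z -> f y = f z -> y = z) -> D x ->
  local_rep D f g (f x) = g x.
Proof.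
move=> fI Dx; apply: xget_subset1; first by exists x.
move=> _ _ [y [Dy fy] <-] [z [Dz fz] <-].
by congr g; apply: fI => //; rewrite fy fz.
Qed.

Section charts.
Context (R : realType) (T : topologicalType) (E : normedModType R).
Implicit Type c : chart T E.

Lemma in_chartE (W : lmodType R) c (g : T -> W) x :
  dom c x -> in_chart c g (c x) = g x.
Proof.
move=> cx; apply: local_repE => // y z cy cz.
by apply: (@chart_inj _ _ _ c); apply/mem_set.
Qed.

Lemma chart_image_open c : open (chart_image c).
Proof. by apply: chart_open => //; exact: dom_open. Qed.

(** Charts are open maps, so neighbourhoods may be transported by them. *)
Lemma near_chart c x (P : set T) (Q : set E) : dom c x -> nbhs x P ->
  (forall y, dom c y -> P y -> Q (c y)) -> nbhs (c x) Q.
Proof.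
move=> cx xP PQ; have : open_nbhs (c x) (c @` (dom c `&` P^°)).
  split; last by exists x.
  by apply: chart_open => [|y []//]; apply: openI; [exact: dom_open|exact: open_interior].
move=> /open_nbhs_nbhs; apply: filterS => _ [y [cy /interior_subset Py] <-].
exact: PQ.
Qed.

End charts.

Section banach_manifold.
Context (R : realType) (E : completeNormedModType R) (M : banachManifold E).

Lemma transition_differentiable (c d : chart M E) x :
  atlas c -> atlas d -> dom c x -> dom d x ->
  differentiable (transition c d) (c x).
Proof.
move=> ac ad cx dx; have [/(_ 1%N)[+ _] _] := atlas_compatible ac ad.
by apply; exists x.
Qed.

(** The coordinates in one chart determine those in all others through the
    differentials of the transition maps. *)
Lemma tangent_eq (x : M) (v w : tangent x) (c : chart M E) :
  atlas c -> dom c x -> v c = w c -> v = w.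
Proof.
move=> ac cx vw; have {vw} : coords v = coords w.
  apply/funext => d; have [[ad dx]|out] := pselect (atlas d /\ dom d x).
    by rewrite !(coords_transition _ ac ad cx dx) vw.
  by rewrite !coords_out.
case: v w => [v vt vo] [w wt wo] /= vw; subst w.
by congr Tangent; exact: Prop_irrelevance.
Qed.

Lemma vfield_differentiable (X : vfield M) (c : chart M E) u :
  atlas c -> chart_image c u -> differentiable (principal X c) u.
Proof. by move=> ac cu; have [+ _] := vf_smooth X ac 1; apply. Qed.

Lemma christoffelE (nabla : vfield M -> vfield M -> vfield M) (c : chart M E) G
    (X Y : vfield M) x : christoffel nabla c G -> dom c x ->
  nabla X Y x c = 'd (principal Y c) (c x) (X x c) - G (c x) (X x c, Y x c).
Proof.
move=> [_ nG] cx; have cu : chart_image c (c x) by exists x.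
by have := nG X Y _ cu; rewrite /principal !in_chartE.
Qed.

End banach_manifold.

(** The relation quantifies over all charts; by the chain rule, applied to the
    transition maps on both sides, a single pair of charts is enough. *)
Lemma tangent_map_relI (R : realType) (E F : completeNormedModType R)
    (M : banachManifold E) (N : banachManifold F) (f : M -> N)
    (x : M) (y : N) (v : tangent x) (w : tangent y) (c : chart M E) (d : chart N F) :
  {for x, continuous f} -> atlas c -> atlas d -> dom c x -> dom d y ->
  y = f x -> differentiable (in_chart c (d \o f)) (c x) ->
  w d = 'd (in_chart c (d \o f)) (c x) (v c) -> tangent_map_rel f v w.
Proof.
move=> fc ac ad cx dy yfx df wd; split=> // c' d' ac' ad' c'x d'y.
pose k := in_chart c (d \o f).
(* Near [c' x] the map read in [c'], [d'] is the one read in [c], [d], framed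
   by the two transition maps. *)
have tc := transition_differentiable ac' ac c'x cx.
have td := transition_differentiable ad ad' dy d'y.
have tcx : transition c' c (c' x) = c x by exact: in_chartE.
have kx : k (c x) = d y by rewrite /k in_chartE// yfx.
have dk : differentiable (k \o transition c' c) (c' x).
  by apply: differentiable_comp => //; rewrite tcx.
have dt : differentiable (transition d d' \o (k \o transition c' c)) (c' x).
  by apply: differentiable_comp => //; rewrite /= tcx kx.
have eqn : \forall u \near c' x,
    (transition d d' \o (k \o transition c' c)) u = in_chart c' (d' \o f) u.
  apply: (@near_chart _ _ _ _ _ [set z | dom c z /\ (dom d (f z))]) => //.
    apply: filterI; first by apply: open_nbhs_nbhs; split=> //; exact: dom_open.
    by apply: fc; apply: open_nbhs_nbhs; split; [exact: dom_open|rewrite -yfx].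
  move=> z c'z [cz dz].
  by rewrite /= /transition (in_chartE c c'z) /k !in_chartE.
have [_ ->] := near_eq_diff eqn dt.
rewrite !diff_comp//=; last 2 first.
- by rewrite tcx.
- by rewrite tcx kx.
rewrite tcx kx (coords_transition w ad ad' dy d'y) wd.
by rewrite (coords_transition v ac' ac c'x cx).
Qed.

(** * Covariant derivatives of related vector fields *)

Section limit_chart.
Context (R : realType) (E : banachSystem R) (M : manifoldSystem E).
Variable c : forall i, chart (M i) (E i).
Hypothesis cP : is_limit_chart c.
Local Notation rho := (rho E).

Lemma near_phi i j (ij : (i <= j)%N) x : dom (c j) x ->
  \forall u \near c j x, rho ij u = in_chart (c j) (c i \o phi M ij) u.
Proof.
move=> cx; apply: (near_chart cx filterT) => y cy _.
by rewrite in_chartE//= lim_chart_phi.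
Qed.

Lemma diff_phi i j (ij : (i <= j)%N) x : dom (c j) x ->
  differentiable (in_chart (c j) (c i \o phi M ij)) (c j x) /\
  'd (in_chart (c j) (c i \o phi M ij)) (c j x) = rho ij :> (E j -> E i).
Proof.
move=> cx; have rc := @rho_continuous _ E i j ij.
have [d ->] := near_eq_diff (near_phi ij cx) (linear_differentiable _ rc).
by rewrite diff_lin.
Qed.

(** In limit charts the connecting maps are linear, hence equal to their own
    differentials. *)
Lemma limit_chart_tangent_map i j (ij : (i <= j)%N) (x : M j) (y : M i)
    (v : tangent x) (w : tangent y) : dom (c j) x -> y = phi M ij x ->
  tangent_map_rel (phi M ij) v w <-> w (c i) = rho ij (v (c j)).
Proof.
move=> cx yx; have [df dE] := diff_phi ij cx.
have cy : dom (c i) y by rewrite yx; exact: lim_dom_phi.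
split=> [[_ /(_ _ _ (lim_atlas cP j) (lim_atlas cP i) cx cy)]|wv].
  by rewrite dE.
apply: tangent_map_relI (lim_atlas cP j) (lim_atlas cP i) cx cy yx df _.
  by have [+ _] := phi_smooth M ij; exact.
by rewrite dE.
Qed.

Lemma related_coords (X : forall i, vfield (M i)) i j (ij : (i <= j)%N) x :
  related X -> dom (c j) x ->
  X i (phi M ij x) (c i) = rho ij (X j x (c j)).
Proof.
move=> XP cx; apply: (limit_chart_tangent_map _ _ cx erefl).1.
exact: (XP c cP).
Qed.

(** Obtained by differentiating [Y i \o rho = rho \o Y j], which holds on the
    open image of [c j]. *)
Lemma related_diff (Y : forall i, vfield (M i)) i j (ij : (i <= j)%N) x v :
  related Y -> dom (c j) x ->
  'd (principal (Y i) (c i)) (rho ij (c j x)) (rho ij v) =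
    rho ij ('d (principal (Y j) (c j)) (c j x) v).
Proof.
move=> YP cx; have rc := @rho_continuous _ E i j ij.
have dY : differentiable (principal (Y i) (c i)) (rho ij (c j x)).
  apply: vfield_differentiable; first exact: lim_atlas.
  by exists (phi M ij x); [exact: lim_dom_phi|exact: lim_chart_phi].
have dYj : differentiable (principal (Y j) (c j)) (c j x).
  by apply: vfield_differentiable; [exact: lim_atlas|exists x].
have eqn : \forall u \near c j x,
    (principal (Y i) (c i) \o rho ij) u = (rho ij \o principal (Y j) (c j)) u.
  apply: (near_chart cx filterT) => y cy _ /=.
  rewrite -(lim_chart_phi cP)// /principal !in_chartE//; last exact: lim_dom_phi.
  exact: related_coords.
have dr y : differentiable (rho ij) y by exact: linear_differentiable.
have [_] := near_eq_diff eqn (differentiable_comp (dr _) dY).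
move=> /(congr1 (fun f => f v)) /=.
have -> := congr1 (fun f => f v) (diff_comp dYj (dr _)).
have -> := congr1 (fun f => f v) (diff_comp (dr _) dY).
by rewrite /= !(diff_lin _ rc) => ->.
Qed.

End limit_chart.

(** Both terms of the local formula commute with [rho]: the derivative by
    [related_diff], the Christoffel term by compatibility of the symbols. *)
Lemma connection_related (R : realType) (E : banachSystem R)
    (M : manifoldSystem E)
    (nabla : forall i, vfield (M i) -> vfield (M i) -> vfield (M i))
    (X Y : forall i, vfield (M i)) :
  projective_connections nabla -> related X -> related Y ->
  related (fun i => nabla i (X i) (Y i)).
Proof.
move=> nP XP YP c cP i j ij x cx; have [G Gc Grho] := nP c cP.
apply: (limit_chart_tangent_map cP _ _ cx erefl).2.
have cy : dom (c i) (phi M ij x) by exact: lim_dom_phi.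
rewrite (christoffelE _ _ (Gc i) cy) (christoffelE _ _ (Gc j) cx).
rewrite !(related_coords cP)// (lim_chart_phi cP)// (related_diff cP)//.
by rewrite linearB Grho//; exists x.
Qed.

(** * Closedness of the limit spaces *)

Lemma cvg_opmap_eval (R : realType) (V W : normedModType R)
    (S : opspace V W) (n : nat) (v : V) :
  (forall (f : opmap S) a x, f (a *: x) = a ^+ n *: f x) ->
  continuous (fun f : opmap S => f v).
Proof.
move=> SZ f; have nF : Filter (nbhs f) by exact: nbhs_filter.
apply/(@cvgrPdist_le _ _ _ (nbhs f) nF) => e e0.
have d0 : 0 < e / (`|v| ^+ n + 1).
  by rewrite divr_gt0// ltr_wpDl ?exprn_ge0.
have /(@cvgrPdist_le _ _ _ (nbhs f) nF)/(_ _ d0) := @cvg_id _ (nbhs f).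
apply: (@filterS _ _ nF) => g fg.
have -> : f v - g v = (f - g) v.
  by rewrite opaddE -scaleN1r -(scaleN1r g) opscaleE.
apply: (le_trans (opnorm_homogeneous _ (SZ _))).
rewrite (le_trans (ler_wpM2r _ fg)) ?exprn_ge0//.
by rewrite mulrAC ler_pdivrMr ?ltr_wpDl ?exprn_ge0// ler_pM2l// lerDl.
Qed.

(** The coherence conditions are equations between continuous functions of the
    components with values in Hausdorff spaces, both here and for [H2_space]. *)
Lemma frechet_space_closed (R : realType) (E : banachSystem R) :
  spclosed (frechet_space E).
Proof.
move=> F x FF Fx i j ij.
apply: (cvg_unique (@norm_hausdorff _ _)) (Fx i).
have -> : (fun y : frechet_limit E => y i) =
    (rho E ij) \o (fun y : frechet_limit E => y j).
  by apply/funext => y /=; rewrite (spvalP y).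
exact: cvg_comp (Fx j) (@rho_continuous _ E i j ij (x j)).
Qed.

Lemma H2_space_closed (R : realType) (E : banachSystem R) :
  spclosed (H2_space E).
Proof.
move=> F B FF FB i j ij x y.
have ev k z : (fun C : H2 E => C k z) @ F --> B k z.
  have evk := @cvg_opmap_eval _ _ _ (bilin_opspace (E k) (E k)) 2 z
    (fun f => bilin_memZ (opfunP f)) (B k).
  exact: cvg_comp (FB k) evk.
apply: (cvg_unique (@norm_hausdorff _ _)) (ev i _) _.
have -> : (fun C : H2 E => C i (rho E ij x, rho E ij y)) =
    (rho E ij) \o (fun C : H2 E => C j (x, y)).
  by apply/funext => C /=; rewrite (spvalP C).
exact: cvg_comp (ev j _) (@rho_continuous _ E i j ij _).
Qed.

(** * Vector fields of the limit in a limit chart *)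

Section limit_fields.
Context (R : realType) (E : banachSystem R) (M : manifoldSystem E).
Variable c : forall i, chart (M i) (E i).
Hypothesis cP : is_limit_chart c.
Implicit Types (m : proj_limit M) (X Y : lvfield M).
Implicit Types Xi Yi : forall i, vfield (M i).

Lemma lim_chart_mapE m i : lim_dom c m -> lim_chart_map c m i = c i (m i).
Proof.
move=> cm; apply: to_subprodE => k j kj.
by rewrite -(pt_coherent m kj) (lim_chart_phi cP).
Qed.

Lemma ltangent_coherent m (v : ltangent m) :
  lim_dom c m -> coherent (fun i => v i (c i)).
Proof.
move=> cm i j ij; apply/esym.
apply: (limit_chart_tangent_map cP _ _ (cm j) _).1; last exact: lt_coherent.
by rewrite pt_coherent.
Qed.

Lemma lim_chart_map_inj m m' :
  lim_dom c m -> lim_dom c m' -> lim_chart_map c m = lim_chart_map c m' -> m = m'.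
Proof.
move=> cm cm' mm'; have {mm'} : pt m = pt m'.
  apply: functional_extensionality_dep => i.
  apply: (@chart_inj _ _ _ (c i)); rewrite ?inE//.
  by rewrite -!lim_chart_mapE// mm'.
case: m m' {cm cm'} => [m mP] [m' mP'] /= mm'; subst m'.
by congr ProjLimit; exact: Prop_irrelevance.
Qed.

Lemma lprincipalE X m i :
  lim_dom c m -> lprincipal X c (lim_chart_map c m) i = X m i (c i).
Proof.
move=> cm; rewrite /lprincipal (local_repE _ _ cm); last exact: lim_chart_map_inj.
by apply: to_subprodE; exact: ltangent_coherent.
Qed.

Lemma lprincipal_vlimit Xi X u i : is_vlimit Xi X -> lim_chart_image c u ->
  lprincipal X c u i = principal (Xi i) (c i) (u i).
Proof.
move=> [_ XX] [m cm <-].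
by rewrite lprincipalE// lim_chart_mapE// /principal in_chartE// XX.
Qed.

(** The difference quotients do not mention [Yi]: the derivative of [Yi i] in
    the direction of a coordinate of a limit vector depends on [Y] alone. This
    uses that the chart image is open in the limit space: a small displacement
    along [v] stays among the points where [Yi i] is given by [Y]. *)
Lemma lprincipal_dirderiv Yi Y m v i : is_vlimit Yi Y -> lim_dom c m ->
  has_dirderiv (fun w => lprincipal Y c w i) (lim_chart_map c m) v
    ('d (principal (Yi i) (c i)) (c i (m i)) (v i)).
Proof.
move=> YY cm; rewrite -lim_chart_mapE//.
have ui : chart_image (c i) (lim_chart_map c m i).
  by rewrite lim_chart_mapE//; exists (m i).
have dY := vfield_differentiable (Yi i) (lim_atlas cP i) ui.
have dYv := differentiable_has_dirderiv (v := v i) dY.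
apply: (@has_dirderiv_congr _ _ _ (lim_chart_image c)
  (fun w : frechet_limit E => principal (Yi i) (c i) (w i))).
- exact: lim_chart_image_open.
- by move=> w cw; rewrite (lprincipal_vlimit _ YY).
- by exists m.
apply: (near_eq_cvg_to _ dYv); near=> h.
by rewrite spaddE spscaleE.
Unshelve. all: by end_near. Qed.

End limit_fields.

Lemma H2_appE (R : realType) (E : banachSystem R) (B : H2 E)
    (x y : frechet_limit E) i : H2_app B x y i = B i (x i, y i).
Proof.
apply: to_subprodE => k j kj.
by rewrite -(spvalP B) (spvalP x) (spvalP y).
Qed.

Lemma ltangent_eq (R : realType) (E : banachSystem R) (M : manifoldSystem E)
    (m : proj_limit M) (v w : ltangent m) : (forall i, v i = w i) -> v = w.
Proof.
case: v w => [v vP] [w wP] /= vw.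
have {}vw := functional_extensionality_dep vw; subst w.
by congr Ltangent; exact: Prop_irrelevance.
Qed.

Lemma lvfield_eq (R : realType) (E : banachSystem R) (M : manifoldSystem E)
    (X Y : lvfield M) : (forall m i, X m i = Y m i) -> X = Y.
Proof.
move=> XY; have {XY} : lvf X = lvf Y.
  by apply: functional_extensionality_dep => m; exact: ltangent_eq.
case: X Y => [X XP] [Y YP] /= XY; subst Y.
by congr Lvfield; exact: Prop_irrelevance.
Qed.

(** * The limit connection *)

Section limit_connection.
Context (R : realType) (E : banachSystem R) (M : manifoldSystem E).
Hypothesis M_charts : has_limit_charts M.
Variable nabla : forall i : nat, vfield (M i) -> vfield (M i) -> vfield (M i).
Arguments nabla : clear implicits.
Hypothesis nabla_projective : projective_connections nabla.
Implicit Types Xi Yi : forall i, vfield (M i).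

Lemma vlimit_exists Xi : related Xi -> exists X : lvfield M, is_vlimit Xi X.
Proof.
move=> XP.
have co (m : proj_limit M) i j (ij : (i <= j)%N) :
    tangent_map_rel (phi M ij) (Xi j (m j)) (Xi i (m i)).
  have [c [cP cm]] := M_charts m.
  by have := XP c cP i j ij (m j) (cm j); rewrite (pt_coherent m ij).
have XV : is_vlimit Xi (fun m => Ltangent (co m)) by split.
by exists (Lvfield (ex_intro _ Xi XV)).
Qed.

(** Without this the covariant derivative of limit fields could depend on the
    fields chosen to represent them, which may differ off the image of [M]. *)
Lemma connection_vlimit_unique (X Y : lvfield M) Xi Yi Xi' Yi'
    (m : proj_limit M) i :
  is_vlimit Xi X -> is_vlimit Yi Y -> is_vlimit Xi' X -> is_vlimit Yi' Y ->
  nabla i (Xi i) (Yi i) (m i) = nabla i (Xi' i) (Yi' i) (m i).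
Proof.
move=> XX YY XX' YY'; have [c [cP cm]] := M_charts m.
have [G Gc _] := nabla_projective cP.
apply: (tangent_eq (lim_atlas cP i) (cm i)).
rewrite !(christoffelE _ _ (Gc i) (cm i)) -XX.2 -YY.2 -XX'.2 -YY'.2.
suff -> : 'd (principal (Yi i) (c i)) (c i (m i)) (X m i (c i)) =
    'd (principal (Yi' i) (c i)) (c i (m i)) (X m i (c i)) by [].
rewrite -(lprincipalE cP X i cm); set v := lprincipal X c _.
have DY := lprincipal_dirderiv (v := v) (i := i) cP YY cm.
have DY' := lprincipal_dirderiv (v := v) (i := i) cP YY' cm.
exact: (cvg_unique (@norm_hausdorff _ _) DY DY').
Qed.

Lemma connection_vlimit_exists (X Y : lvfield M) : exists Z : lvfield M,
  forall Xi Yi, is_vlimit Xi X -> is_vlimit Yi Y ->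
  is_vlimit (fun i => nabla i (Xi i) (Yi i)) Z.
Proof.
have [Xi XX] := lvf_limit X; have [Yi YY] := lvf_limit Y.
have [Z [_ ZE]] := vlimit_exists (connection_related nabla_projective XX.1 YY.1).
exists Z => Xi' Yi' XX' YY'; split.
  exact: connection_related nabla_projective XX'.1 YY'.1.
by move=> m i; rewrite ZE; exact: connection_vlimit_unique XX YY XX' YY'.
Qed.

Lemma connection_limit_exists : exists lnabla, connection_limit nabla lnabla.
Proof.
have /choice[f fP] := fun p => connection_vlimit_exists p.1 p.2.
by exists (fun X Y => f (X, Y)) => X Y; exact: (fP (X, Y)).
Qed.

Lemma connection_limit_unique lnabla lnabla' :
  connection_limit nabla lnabla -> connection_limit nabla lnabla' ->
  lnabla = lnabla'.
Proof.
move=> nP nP'; apply/funext => X; apply/funext => Y; apply: lvfield_eq => m i.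
have [Xi XX] := lvf_limit X; have [Yi YY] := lvf_limit Y.
by rewrite (nP _ _ _ _ XX YY).2 (nP' _ _ _ _ XX YY).2.
Qed.

(** The symbol of the limit is the sequence of the symbols at all levels, taken
    at the coordinates of the point. Its smoothness is [lcCk_subprod] over
    [H2_space]; the local formula is [christoffelE] read at each level. *)
Lemma connection_limit_is_connection lnabla :
  connection_limit nabla lnabla -> is_limit_connection lnabla.
Proof.
move=> nP c cP; have [Gi Gc Grho] := nabla_projective cP.
have cui u : lim_chart_image c u -> forall i, chart_image (c i) (u i).
  by move=> [m cm <-] i; rewrite (lim_chart_mapE cP)//; exists (m i).
have Gco u : lim_chart_image c u -> coherent2 (fun i => Gi i (u i)).
  by move=> cu i j ij x y; rewrite Grho; [rewrite (spvalP u)|exact: cui].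
have oU := lim_chart_image_open cP.
exists (fun u => to_subprod (H2_space E) (fun i => Gi i (u i))); split.
- exists Gi => [i|u cu i]; first by have [] := Gc i.
  by rewrite to_subprodE//; exact: Gco.
- move=> n; apply: (lcCk_subprod (@H2_space_closed _ E)) => // i.
  pose p (u : frechet_limit E) : E i := u i.
  apply: (@lcCk_congr _ _ _ _ _ (Gi i \o p)) => //.
    by move=> u cu; rewrite /= to_subprodE//; exact: Gco.
  apply: (@lcCk_comp_linear _ _ _ _ _ p _ (chart_image (c i))).
  + by move=> a x y; rewrite /p spaddE spscaleE.
  + exact: subprod_proj_continuous.
  + by move=> u /cui.
  + by apply: Ck_lcCk; have [+ _] := Gc i; apply.
move=> X Y u [m cm <-].
have [Xi XX] := lvf_limit X; have [Yi YY] := lvf_limit Y.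
pose v := lprincipal X c (lim_chart_map c m).
(* The derivatives of the components form an element of the limit space,
   because that space is closed. *)
have [dco dY] := has_dirderiv_subprod (@frechet_space_closed _ E)
  (fun i => lprincipal_dirderiv (i := i) cP (v := v) YY cm).
exists (to_limit (fun i => 'd (principal (Yi i) (c i)) (c i (m i)) (v i))) => //.
apply: subprod_eq => i.
rewrite lprincipalE// (nP _ _ _ _ XX YY).2 (christoffelE _ _ (Gc i) (cm i)).
rewrite spsubE to_subprodE// /v lprincipalE//.
rewrite -XX.2 -YY.2; congr (_ - _).
rewrite H2_appE to_subprodE; last by apply: Gco; exists m.
by rewrite lim_chart_mapE// !lprincipalE.
Qed.

End limit_connection.

Theorem theorem3p1 (R : realType) (E : banachSystem R) (M : manifoldSystem E)
    (M_charts : has_limit_charts M)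
    (nabla : forall i : nat, vfield (M i) -> vfield (M i) -> vfield (M i))
    (nabla_connection : forall i : nat, is_connection (nabla i))
    (nabla_projective : projective_connections nabla) :
  exists lnabla : lvfield M -> lvfield M -> lvfield M,
    unique (connection_limit nabla) lnabla /\ is_limit_connection lnabla.
Proof.
have [lnabla nP] := connection_limit_exists M_charts nabla_projective.
exists lnabla; split; last exact: connection_limit_is_connection nP.
by split=> // lnabla'; exact: connection_limit_unique.
Qed.
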